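(* Let $X,Y$ be sets and $f,g:X\to Y$ functions. Let $\sim$ be the equivalence relation on $Y$ induced (generated) by the pairs $\langle f(x),g(x)\rangle$ for $x\in X$; this relation consists of all pairs $\langle y,y'\rangle\in Y\times Y$ such that there exist $n\ge 0$ and $y_0,y_1,\ldots,y_n\in Y$ with $y=y_0$, $y'=y_n$, and for each $i=1,\ldots,n$, either $\langle y_{i-1},y_i\rangle=\langle f(x),g(x)\rangle$ or $\langle y_{i-1},y_i\rangle=\langle g(x),f(x)\rangle$ for some $x\in X$. Let $C=Y/{\sim}$ and let $[\cdot]:Y\to C$ be the canonical map. Then $C$ together with $[\cdot]$ is a coequalizer of $f$ and $g$ in the category of sets and functions.
   Context: A coequalizer of two morphisms $f,g:X\to Y$ is an object $C$ with a morphism $c:Y\to C$ such that $c\circ f=c\circ g$ and such that for any morphism $m:Y\to P$ with $m\circ f=m\circ g$ there exists a unique morphism $u:C\to P$ with $u\circ c=m$. $\langle x,y\rangle$ denotes an ordered pair. *)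

(* Defs.v *)
From Stdlib Require Import Relations.

Set Implicit Arguments.
Unset Strict Implicit.
Unset Printing Implicit Defensive.

Record category := Category {
  obj :> Type;
  hom : obj -> obj -> Type;
  idm : forall A, hom A A;
  comp : forall A B D, hom B D -> hom A B -> hom A D;
  comp_idl : forall A B (h : hom A B), comp (idm B) h = h;
  comp_idr : forall A B (h : hom A B), comp h (idm A) = h;
  comp_assoc : forall A B D E (k : hom D E) (h : hom B D) (j : hom A B),
    comp k (comp h j) = comp (comp k h) j
}.

Arguments hom {c} _ _.
Arguments idm {c} _.
Arguments comp {c A B D} _ _.

Definition is_coequalizer (K : category) (X Y : K) (f g : hom X Y)
    (C : K) (c : hom Y C) : Prop :=
  comp c f = comp c g /\
  forall (P : K) (m : hom Y P), comp m f = comp m g ->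
    exists! u : hom C P, comp u c = m.

(* Sets are types; equality of morphisms is Leibniz equality of functions. *)
Definition SET : category :=
  @Category Type (fun X Y => X -> Y) (fun X x => x)
    (fun X Y Z k h x => k (h x))
    (fun _ _ _ => eq_refl) (fun _ _ _ => eq_refl)
    (fun _ _ _ _ _ _ _ => eq_refl).

(* [clos_refl_sym_trans] is the least equivalence relation containing its
   argument, here the set of pairs <f x, g x>. *)
Definition induced_equiv (X Y : Type) (f g : X -> Y) : relation Y :=
  clos_refl_sym_trans Y (fun y y' => exists x, (y, y') = (f x, g x)).

(* The points of Y/E are the equivalence classes themselves, that is, the
   subsets of Y of the form { z | E y z }. *)
Definition quotient (Y : Type) (E : relation Y) : Type :=
  { A : Y -> Prop | exists y, A = (fun z => E y z) }.

Definition class_of (Y : Type) (E : relation Y) (y : Y) : quotient E :=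
  exist _ (fun z => E y z) (ex_intro _ y eq_refl).

(* Main.v *)
Require Import Defs.
From Stdlib Require Import Relations.
From Stdlib Require Import Lia FunctionalExtensionality PropExtensionality.
From Stdlib Require Import ProofIrrelevance IndefiniteDescription.

(** The chain description unfolds the generated equivalence into single links, each used in either
    direction ([clos_rst_iff_chain]). The map [class_of] identifies [f x] with [g x] because they
    are related. If [m] equalizes [f] and [g], it is constant on classes ([induced_equiv_compat]),
    so it factors through the quotient, uniquely since [class_of] is onto ([quotient_universal]). *)

Lemma clos_rst_iff_chain (A : Type) (R : relation A) (a b : A) :
  clos_refl_sym_trans A R a b <->
  exists (n : nat) (s : nat -> A),
    a = s 0 /\ b = s n /\
    forall i : nat, 1 <= i <= n -> R (s (i - 1)) (s i) \/ R (s i) (s (i - 1)).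
Proof.
split.
- intros H%clos_rst_rst1n.
  induction H as [a|a c b Hac _ (n & s & Ha & Hb & Hs)].
  + exists 0, (fun _ => a); repeat split; lia.
  (* Prepend [a]: link 1 is the new step, the later links are those of [s] shifted by one. *)
  + exists (S n), (fun i => match i with 0 => a | S j => s j end).
    repeat split; trivial.
    intros [|[|i]] Hi; [lia| |]; simpl.
    * now rewrite <- Ha.
    * specialize (Hs (S i)); simpl in Hs; rewrite PeanoNat.Nat.sub_0_r in Hs.
      apply Hs; lia.
- intros (n & s & -> & -> & Hs).
  induction n as [|n IH]; [apply rst_refl|].
  apply rst_trans with (s n).
  + apply IH; intros i Hi; apply Hs; lia.
  + destruct (Hs (S n)) as [H|H]; [lia| |];
      simpl in H; rewrite PeanoNat.Nat.sub_0_r in H.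
    * now apply rst_step.
    * now apply rst_sym, rst_step.
Qed.

(** Symmetry and transitivity give both classes the same members; extensionality makes the
    predicates equal, and proof irrelevance the subset elements. *)
Lemma class_of_eq (Y : Type) (E : relation Y) (HE : equivalence Y E) (y z : Y) :
  E y z -> class_of E y = class_of E z.
Proof.
destruct HE as [_ Htrans Hsym]; intros Hyz.
apply subset_eq_compat, functional_extensionality; intros w.
apply propositional_extensionality; split; intros Hw.
- exact (Htrans _ _ _ (Hsym _ _ Hyz) Hw).
- exact (Htrans _ _ _ Hyz Hw).
Qed.

Lemma class_of_surj (Y : Type) (E : relation Y) (q : quotient E) :
  exists y, class_of E y = q.
Proof.
destruct q as [A [y HA]]; exists y.
now apply subset_eq_compat.
Qed.

Lemma class_of_inj (Y : Type) (E : relation Y) (HE : equivalence Y E) (y z : Y) :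
  class_of E y = class_of E z -> E y z.
Proof.
intros H; apply (f_equal (@proj1_sig _ _)) in H; simpl in H.
rewrite (f_equal (fun A => A z) H); apply (equiv_refl _ _ HE).
Qed.

(** The factorization evaluates [m] at a chosen representative [r q] of each class [q]; by [Hm] the
    choice does not affect the value. *)
Lemma quotient_universal (Y P : Type) (E : relation Y) (HE : equivalence Y E)
    (m : Y -> P) (Hm : forall y z, E y z -> m y = m z) :
  exists! u : quotient E -> P, (fun y => u (class_of E y)) = m.
Proof.
destruct (functional_choice _ (class_of_surj Y E)) as [r Hr].
exists (fun q => m (r q)); split.
- apply functional_extensionality; intros y.
  apply Hm, (class_of_inj _ _ HE), Hr.
- intros v <-; apply functional_extensionality; intros q.
  now rewrite Hr.
Qed.

Lemma induced_equiv_equivalence (X Y : Type) (f g : X -> Y) :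
  equivalence Y (induced_equiv f g).
Proof. apply clos_rst_is_equiv. Qed.

(** The kernel of [m] is an equivalence relation containing the generating pairs, hence also the one
    they generate. *)
Lemma induced_equiv_compat (X Y P : Type) (f g : X -> Y) (m : Y -> P) :
  (forall x, m (f x) = m (g x)) ->
  forall y z, induced_equiv f g y z -> m y = m z.
Proof.
intros Hm y z H; induction H as [y z [x [= -> ->]]| | |]; congruence.
Qed.

(* The family y_0, ..., y_n is given by a function on nat of which only the
   values at 0, ..., n matter. *)
Theorem lemma2p5p1 (X Y : Type) (f g : X -> Y) :
  (forall y y' : Y,
     induced_equiv f g y y' <->
     exists (n : nat) (ys : nat -> Y),
       y = ys 0 /\ y' = ys n /\
       forall i : nat, 1 <= i <= n ->
         exists x : X,
           (ys (i - 1), ys i) = (f x, g x) \/ (ys (i - 1), ys i) = (g x, f x))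
  /\
  @is_coequalizer SET X Y f g
    (quotient (induced_equiv f g)) (@class_of Y (induced_equiv f g)).
Proof.
pose proof (induced_equiv_equivalence _ _ f g) as HE.
split; [|split].
- intros y y'; unfold induced_equiv; rewrite clos_rst_iff_chain.
  split; intros (n & s & Hy & Hy' & Hs); exists n, s;
    repeat split; trivial; intros i Hi.
  + destruct (Hs i Hi) as [[x Hx]|[x Hx]]; exists x; [now left|right; congruence].
  + destruct (Hs i Hi) as [x [Hx|Hx]]; [left|right]; exists x; congruence.
- apply functional_extensionality; intros x.
  apply (class_of_eq _ _ HE), rst_step; now exists x.
- intros P m Hm; apply (quotient_universal _ _ _ HE), induced_equiv_compat.
  intros x; exact (f_equal (fun h => h x) Hm).
Qed.
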